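(* Let $K$ be a field of characteristic zero and let $n\ge1$, $d\ge0$ be integers. The $K$-vector space of balancings over $K$ on the complete $d$-complex on $n$ vertices $\Delta_{n,d}$ has dimension $\binom{n+d-1}{d+1}$.
   Context: A $d$-simplex on $\{1,\ldots,n\}$ is a multiset of cardinality $d+1$ with elements in $\{1,\ldots,n\}$; a $d$-complex is a set of $d$-simplices. The complete $d$-complex on $n$ vertices $\Delta_{n,d}$ is the set of all $d$-simplices on $\{1,\ldots,n\}$. $m(i\in S)$ is the multiplicity of $i$ in the multiset $S$, and $m(T\subseteq S)=\prod_{i}\binom{m(i\in S)}{m(i\in T)}$ (zero if $T\not\subseteq S$). A balancing over $K$ on a $d$-complex $\Delta$ is a function $w:\Delta\to K$ (zero values allowed) such that $\sum_{S\subseteq\sigma\in\Delta}w(\sigma)\,m(S\subseteq\sigma)=0$ for every multiset $S$ on $\{1,\ldots,n\}$ with $0\le|S|\le d$. *)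

(* Defs.v *)
From HB Require Import structures.
From mathcomp Require Import all_boot all_order all_algebra.
From mathcomp Require Export finmap multiset.

Set Implicit Arguments.
Unset Strict Implicit.
Unset Printing Implicit Defensive.
Import GRing.Theory.
Local Open Scope ring_scope.
Local Open Scope mset_scope.

(* The vertices are 'I_n = {0, ..., n-1} instead of {1, ..., n}. *)
Definition kmset (n k : nat) := {S : {mset 'I_n} | size S == k}.

HB.instance Definition _ (n k : nat) := SubType.on (kmset n k).
HB.instance Definition _ (n k : nat) := [Choice of kmset n k by <:].

Definition kmset_tuple (n k : nat) (S : kmset n k) : k.-tuple 'I_n :=
  Tuple (valP S).

Lemma size_seq_mset (n k : nat) (t : k.-tuple 'I_n) :
  size (seq_mset t : {mset 'I_n}) == k.
Proof. by rewrite (perm_size (perm_eq_seq_mset t)) size_tuple. Qed.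

Definition tuple_kmset (n k : nat) (t : k.-tuple 'I_n) : kmset n k :=
  Sub (seq_mset t : {mset 'I_n}) (size_seq_mset t).

Lemma kmset_tupleK (n k : nat) : cancel (@kmset_tuple n k) (@tuple_kmset n k).
Proof. by move=> S; apply: val_inj; rewrite SubK /= seq_mset_id. Qed.

HB.instance Definition _ (n k : nat) := CanIsCountable (@kmset_tupleK n k).
HB.instance Definition _ (n k : nat) : isFinite (kmset n k) :=
  CanIsFinite (@kmset_tupleK n k).

Notation simplex n d := (kmset n d.+1).

Notation complex n d := {set simplex n d}.

Definition complete_complex (n d : nat) : complex n d := [set: simplex n d].

(* m(T ⊆ S); it vanishes if T is not contained in S since 'C(p, q) = 0
   for p < q. *)
Definition mult_sub (n : nat) (T S : {mset 'I_n}) : nat :=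
  (\prod_(i < n) 'C(S i, T i))%N.

(* K^o is K seen as a vector space over itself. *)
Notation weight K D := {ffun {sigma | sigma \in D} -> K^o}.

Section Balancing.

Variables (K : fieldType) (n d : nat) (D : complex n d).

Definition balance_sum (w : weight K D) (S : {mset 'I_n}) : K :=
  \sum_(sigma : {sigma | sigma \in D} | S `<=` val (val sigma))
    w sigma * (mult_sub S (val (val sigma)))%:R.

Definition balancing (w : weight K D) : Prop :=
  forall S : {mset 'I_n}, (size S <= d)%N -> balance_sum w S = 0.

(* The multisets of cardinality at most d, as a finite type. *)
Definition small_mset := {k : 'I_d.+1 & kmset n k}.

Definition balance_map (w : weight K D) : {ffun small_mset -> K^o} :=
  [ffun S => balance_sum w (val (tagged S))].

Lemma balance_map_linear : linear balance_map.
Proof.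
move=> a u v; apply/ffunP => S; rewrite !ffunE /balance_sum.
rewrite /GRing.scale /= mulr_sumr -big_split /=.
by apply: eq_bigr => sigma _; rewrite !ffunE /GRing.scale /= mulrDl mulrA.
Qed.

HB.instance Definition _ :=
  GRing.isLinear.Build K (weight K D) {ffun small_mset -> K^o} _ balance_map
    balance_map_linear.

Definition balancing_space : {vspace weight K D} := lker (linfun balance_map).

Lemma balancing_spaceP (w : weight K D) :
  reflect (balancing w) (w \in balancing_space).
Proof.
rewrite memv_ker lfunE /=; apply: (iffP eqP) => [w0 S leSd | bal_w].
  pose T : small_mset :=
    Tagged (fun k : 'I_d.+1 => kmset n k)
      (Sub S (eqxx (size S)) : kmset n (Ordinal (leSd : size S < d.+1)%N)).
  by move/ffunP: w0 => /(_ T); rewrite !ffunE.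
apply/ffunP => -[k S]; rewrite !ffunE; apply: bal_w => /=.
by rewrite (eqP (valP S)) -ltnS.
Qed.

End Balancing.

Arguments balancing_space K {n d} D.

(* Main.v *)
Require Import Defs.
From mathcomp Require Import all_boot all_order all_algebra.
From HB Require Import structures.

(** Let L send a weight w on the d-simplices to the family of its balance sums
    over the multisets S with exactly d elements.

    The kernel of L is the space of balancings.  Grow a multiset S, size S <= d,
    by one vertex i in all possible ways: the identity
      sum_i (S i + 1) m(S + i <= sigma) = (d + 1 - size S) m(S <= sigma)
    (mult_subD1 summed over i) expresses d + 1 - size S times the balance sum
    over S through balance sums over multisets with one more element.  The
    factor d + 1 - size S is invertible in characteristic zero, so the
    conditions at size d imply all those at smaller sizes (balancing_top).

    L is onto for the complete complex.  Fix a vertex v.  The simplices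
    containing a d-multiset S are the S + i, and S + v is the only one among
    them with more than S v copies of v; the equation L w = g at S
    therefore gives the value of w at S + v from its values at simplices with
    fewer copies of v.  This triangular system is solved by recursion on the
    number of copies of v (top_map_surj); the diagonal coefficients
    m(S <= S + v) = S v + 1 are again nonzero in characteristic zero.

    By the rank theorem the dimension is the number of multisets of size d + 1
    minus the number of multisets of size d, and Pascal's rule concludes.

    In polynomial terms, w is the coefficient family of a form of degree d + 1
    in n variables, the balance sums are its divided derivatives at
    (1, ..., 1), and L is the derivation sum_i d/dx_i from forms of degree d + 1
    to forms of degree d. *)

Set Implicit Arguments.
Unset Strict Implicit.
Import GRing.Theory.
Local Open Scope mset_scope.

Section Multisets.

Variable n : nat.
Implicit Types (S T : {mset 'I_n}) (i v : 'I_n).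

Lemma size_mset_sum S : size S = \sum_(i < n) S i.
Proof.
under eq_bigr do rewrite -count_mem_mset.
elim: (S : seq 'I_n) => [|x s IHs] /=; first by rewrite big1.
rewrite big_split -IHs /= -add1n (bigD1 x) //= eqxx big1 // => i.
by rewrite eq_sym => /negPf->.
Qed.

Lemma size_msetD1 i S : size (i +` S) = (size S).+1.
Proof.
rewrite !size_mset_sum; under eq_bigr do rewrite mset1DE.
by rewrite big_split /= (bigD1 i) //= eqxx big1 => [|j /negPf->];
   rewrite ?addn0 ?add1n.
Qed.

Lemma size_msetB S T : T `<=` S -> size (S `\` T) = size S - size T.
Proof.
move=> /msubsetP leTS; rewrite !size_mset_sum -sumnB //.
by apply: eq_bigr => i _; rewrite msetE2.
Qed.

(** Among the one-element extensions of S, adding v is the only one that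
    changes the number of copies of v; this makes the linear system solved
    below triangular. *)
Lemma mem_one_extension v S T :
  S `<=` T -> size T = (size S).+1 -> T != v +` S -> T v = S v.
Proof.
move=> leST sizeT; apply: contraNeq => neq_v.
have le_vST : v +` S `<=` T.
  apply/msubsetP => j; rewrite mset1DE; have /msubsetP/(_ j) := leST.
  by case: eqP => // ->; rewrite leq_eqVlt eq_sym (negPf neq_v).
rewrite eqEmsubset le_vST andbT -msetB_eq0 -size_mset_eq0.
by rewrite size_msetB // sizeT size_msetD1 subnn.
Qed.

(** Sorting identifies multisets with nondecreasing tuples. *)
Lemma card_kmset k : 0 < n -> #|{: kmset n k}| = 'C(k + n.-1, k).
Proof.
case: n => // m _; rewrite -card_sorted_tuples.
pose le := relpre (@nat_of_ord m.+1) leq.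
have le_total : total le by move=> i j; apply: leq_total.
rewrite -(card_in_imset (f := @tuple_kmset m.+1 k)) => [|t u].
  apply: eq_card => S; rewrite inE; apply/esym/imsetP.
  have sort_size : size (sort le (val S)) == k.
    by rewrite size_sort (eqP (valP S)).
  exists (Tuple sort_size); first by rewrite inE sorted_map sort_sorted.
  apply: val_inj; rewrite SubK -[LHS]seq_mset_id; apply/eq_seq_msetP.
  by rewrite perm_sym perm_sort.
rewrite !inE => t_sorted u_sorted /(congr1 val); rewrite !SubK.
move=> /eq_seq_msetP perm_tu; apply/val_inj/(inj_map val_inj).
apply: (sorted_eq leq_trans anti_leq t_sorted u_sorted).
exact: perm_map.
Qed.

Lemma mult_sub_gt0 S T : (0 < mult_sub S T) = (S `<=` T).
Proof.
apply/idP/msubsetP => [m_gt0 i|leST].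
  rewrite -bin_gt0; move: m_gt0; rewrite /mult_sub (bigD1 i) //= muln_gt0.
  by case/andP.
by apply: prodn_gt0 => i; rewrite bin_gt0.
Qed.

Lemma mult_subD1 i S T :
  (S i).+1 * mult_sub (i +` S) T = (T i - S i) * mult_sub S T.
Proof.
rewrite /mult_sub !(bigD1 (P := predT) i) //= mset1DE eqxx add1n.
rewrite !mulnA mul_bin_left.
by congr (_ * _); apply: eq_bigr => j /negPf ji; rewrite mset1DE ji.
Qed.

Lemma sum_mult_subD1 S T :
  \sum_(i < n) (S i).+1 * mult_sub (i +` S) T
    = (size T - size S) * mult_sub S T.
Proof.
under eq_bigr do rewrite mult_subD1.
rewrite -big_distrl /=.
(* Truncated differences add up correctly only when S is contained in T. *)
case: (posnP (mult_sub S T)) => [->|]; first by rewrite !muln0.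
by rewrite mult_sub_gt0 => /msubsetP leST; rewrite !size_mset_sum sumnB.
Qed.

End Multisets.

Section TopBalance.

Local Open Scope ring_scope.

Variables (K : fieldType) (n d : nat).
Implicit Types (D : complex n d) (S : {mset 'I_n}).

Lemma balance_sumE D (w : weight K D) S :
  balance_sum w S = \sum_sigma w sigma * (mult_sub S (val (val sigma)))%:R.
Proof.
rewrite /balance_sum big_mkcond; apply: eq_bigr => sigma _.
by case: ifPn => //; rewrite -mult_sub_gt0 -eqn0Ngt => /eqP->; rewrite mulr0.
Qed.

Lemma sum_balance_sumD1 D (w : weight K D) S :
  \sum_(i < n) (S i).+1%:R * balance_sum w (i +` S) =
    (d.+1 - size S)%N%:R * balance_sum w S.
Proof.
under eq_bigr do rewrite balance_sumE mulr_sumr.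
rewrite exchange_big balance_sumE mulr_sumr; apply: eq_bigr => sigma _ /=.
under eq_bigr do rewrite mulrCA -natrM.
rewrite -mulr_sumr -natr_sum sum_mult_subD1 (eqP (valP (val sigma))).
by rewrite natrM mulrCA.
Qed.

Definition top_map D (w : weight K D) : {ffun kmset n d -> K^o} :=
  [ffun S => balance_sum w (val S)].

Lemma top_map_linear D : linear (@top_map D).
Proof.
move=> a u v; apply/ffunP => S; rewrite !ffunE !balance_sumE.
rewrite scaler_sumr -big_split /=.
by apply: eq_bigr => sigma _; rewrite !ffunE mulrDl scalerAl.
Qed.

HB.instance Definition _ D :=
  GRing.isLinear.Build K (weight K D) {ffun kmset n d -> K^o} _ (@top_map D)
    (@top_map_linear D).

Hypothesis charK : [pchar K] =i pred0.

Let natr_neq0 m : (m%:R != 0 :> K) = (0 < m)%N.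
Proof. by move/pcharf0P: charK => ->; rewrite lt0n. Qed.

(** Downward induction on the size of S: by sum_balance_sumD1 the balance sum
    over S is, up to the factor d + 1 - size S, a combination of balance sums
    over larger multisets. *)
Lemma balancing_top D (w : weight K D) :
  balancing w <-> (forall S : kmset n d, balance_sum w (val S) = 0).
Proof.
split=> [bal_w S | top_w S leSd].
  by apply: bal_w; rewrite (eqP (valP S)).
move def_k: (d - size S)%N => k.
elim: k S leSd def_k => [|k IHk] S leSd def_k.
  have sizeS : size S == d by rewrite eqn_leq leSd -subn_eq0 def_k /=.
  exact: (top_w (Sub S sizeS)).
apply: (@mulfI _ (d.+1 - size S)%N%:R); first by rewrite natr_neq0 subn_gt0.
rewrite mulr0 -sum_balance_sumD1 big1 // => i _.
by rewrite IHk ?mulr0 // size_msetD1 ?subnS ?def_k // -subn_gt0 def_k.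
Qed.

Lemma balancing_space_top D : balancing_space K D = lker (linfun (@top_map D)).
Proof.
apply/vspaceP => w; rewrite [RHS]memv_ker lfunE.
apply/balancing_spaceP/eqP => [/balancing_top top_w | /ffunP top_w].
  by apply/ffunP => S; rewrite !ffunE top_w.
by apply/balancing_top => S; move: (top_w S); rewrite !ffunE.
Qed.

Local Notation Delta := (complete_complex n d).

(** Stage k of the recursion solving top_map w = g: it is the sought weight on
    the simplices sigma with exactly k copies of v.  The formula is the
    equation at S = sigma - v solved for the weight of sigma; the other
    simplices containing S have k - 1 copies of v, hence the previous stage.  A simplex that avoids v
    may be given any value, here zero. *)
Fixpoint solve_top (v : 'I_n) (g : {mset 'I_n} -> K) (k : nat) :
    weight K Delta :=
  if k isn't k'.+1 then 0 else
  [ffun sigma => let S := val (val sigma) `\ v in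
    (g S - \sum_(tau | tau != sigma)
             solve_top v g k' tau * (mult_sub S (val (val tau)))%:R)
      / (mult_sub S (val (val sigma)))%:R].

Lemma top_map_surj (v : 'I_n) (g : {ffun kmset n d -> K^o}) :
  exists w : weight K Delta, top_map w = g.
Proof.
pose g' S : K := if insub S is Some S' then g S' else 0.
(* Each simplex is evaluated at the stage given by its multiplicity at v. *)
exists [ffun sigma : {x | x \in Delta} =>
          solve_top v g' (val (val sigma) v) sigma].
apply/ffunP => S; rewrite !ffunE balance_sumE.
have size_vS : size (v +` val S) == d.+1.
  by rewrite size_msetD1 (eqP (valP S)).
pose sigma : {sigma | sigma \in Delta} :=
  Sub (Sub (v +` val S) size_vS : simplex n d) (in_setT _).
have val_sigma : val (val sigma) = v +` val S by [].
rewrite (bigD1 sigma) //= !ffunE val_sigma mset1DE eqxx add1n /=.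
rewrite ffunE val_sigma msetD1K divfK; last first.
  rewrite natr_neq0 mult_sub_gt0; apply/msubsetP => j.
  by rewrite mset1DE leq_addl.
rewrite /g' valK -[RHS](subrK (\sum_(tau | tau != sigma)
  solve_top v g' (val S v) tau * (mult_sub (val S) (val (val tau)))%:R)).
congr (_ + _); apply: eq_bigr => tau neq_tau; rewrite ffunE.
have [leS|] := boolP (val S `<=` val (val tau)); last first.
  by rewrite -mult_sub_gt0 -eqn0Ngt => /eqP->; rewrite !mulr0.
(* All other simplices containing S share the stage S v. *)
rewrite (@mem_one_extension n v (val S)) //.
by rewrite (eqP (valP S)) (eqP (valP (val tau))).
Qed.

End TopBalance.

Theorem proposition5p3 (K : fieldType) (n d : nat)
    (charK : [pchar K]%R =i pred0) (n_gt0 : 0 < n) :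
  \dim (balancing_space K (complete_complex n d)) = 'C(n + d - 1, d.+1).
Proof.
rewrite balancing_space_top //; set f := linfun _.
have surj_f : limg f = fullv.
  apply/vspaceP => g; rewrite memvf.
  have [w <-] := top_map_surj charK (Ordinal n_gt0) g.
  by rewrite -[top_map _]lfunE memv_img ?memvf.
have := limg_ker_dim f fullv; rewrite capfv surj_f !dimvf.
rewrite /dim /= !muln1 card_sig.
have -> : #|[pred x in complete_complex n d]| = #|{: simplex n d}|.
  by apply: eq_card => x; rewrite !inE.
rewrite !card_kmset //.
case: n n_gt0 {surj_f} f => // m _ f /=.
rewrite [(m.+1 + d)%N]addSn subn1 /= [(m + d)%N]addnC.
by rewrite [(d.+1 + m)%N]addSn binS => /eqP; rewrite eqn_add2r => /eqP.
Qed.
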